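(* Let $L_1(x),L_2(x),L_3(x),\ldots$ be the Lucas polynomials, indexed so that $L_1(x)=1$, $L_2(x)=x$, $L_3(x)=2L_1(x)+xL_2(x)$, and $L_{k+1}(x)=L_{k-1}(x)+xL_k(x)$ for $k>2$. Then for every natural number $n\ge 1$, \[L_{n+1}(x)= \left|\begin{array}{rrrrrr} x&2&0&\cdots&0&0\\ -1&x&1&\cdots&0&0\\ 0&-1&x&\cdots&0&0\\ \vdots&\vdots&\vdots&\ddots&\vdots&\vdots\\ 0&0&0&\cdots&x&1\\ 0&0&0&\cdots&-1&x\end{array}\right|,\] where the determinant has size $n$; that is, the matrix is the $n\times n$ tridiagonal matrix with all diagonal entries equal to $x$, all subdiagonal entries equal to $-1$, $(1,2)$ entry equal to $2$, and all other superdiagonal entries equal to $1$.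
   Context: The indexing of the Lucas polynomials used here is the one given by the recurrence in the claim (so $L_2(x)=x$, $L_3(x)=x^2+2$), and not the other common convention in which $L_1(x)=x$. *)

(* Defs.v *)
From mathcomp Require Import all_boot all_order all_algebra.

Set Implicit Arguments.
Unset Strict Implicit.
Unset Printing Implicit Defensive.

Import GRing.Theory.
Local Open Scope ring_scope.

(* Indexed from 1, with lucas 1 = 1 and lucas 2 = 'X, rather than with the other
   common convention where the polynomial of index 1 is 'X; the value at index 0
   is a placeholder. *)
Fixpoint lucas (R : comNzRingType) (n : nat) : {poly R} :=
  match n with
  | 0 => 0
  | 1 => 1
  | (m.+1 as k).+1 =>
      match m with
      | 0 => 'X
      | 1 => 2 * lucas R m + 'X * lucas R k
      | _ => lucas R m + 'X * lucas R k
      end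
  end.

Lemma lucas1 (R : comNzRingType) : lucas R 1 = 1.
Proof. by []. Qed.

Lemma lucas2 (R : comNzRingType) : lucas R 2 = 'X.
Proof. by []. Qed.

Lemma lucas3 (R : comNzRingType) :
  lucas R 3 = 2 * lucas R 1 + 'X * lucas R 2.
Proof. by []. Qed.

Lemma lucasS (R : comNzRingType) (k : nat) :
  (2 < k)%N -> lucas R k.+1 = lucas R k.-1 + 'X * lucas R k.
Proof. by case: k => [|[|[|k]]]. Qed.

(* Row and column indices start at 0, so the entry in row 1, column 2 of the
   usual numbering is the one with i = 0 and j = 1. *)
Definition lucas_mx (R : comNzRingType) (n : nat) : 'M[{poly R}]_n :=
  \matrix_(i < n, j < n)
    if i == j :> nat then 'X
    else if i == j.+1 :> nat then -1
    else if j == i.+1 :> nat then (if i == 0 :> nat then 2 else 1)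
    else 0.

(* Main.v *)
Require Import Defs.
From mathcomp Require Import all_boot all_order all_algebra.
Local Open Scope ring_scope.
Import GRing.Theory.

(** Expanding the determinant of a tridiagonal matrix along its last row, and
    then the off-diagonal minor along its last column, expresses it through the
    two preceding leading principal minors ([det_tridiag]). For the matrix at
    hand the product of the two off-diagonal entries at the corner is -2 in
    size 2 and -1 in every larger size, so its determinants obey exactly the
    recurrence of the Lucas polynomials, exceptional step included. The
    initial values also agree when the determinant of size 0, namely 1, is
    matched with the first polynomial, so the induction starts there. *)

(** Taking the entries from a function on [nat] makes all the matrices of the
    family leading principal submatrices of one another. *)
Definition leading_mx (R : comNzRingType) (F : nat -> nat -> R) (n : nat) :
  'M[R]_n := \matrix_(i < n, j < n) F i j.
Arguments leading_mx {R} F n.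

Lemma leading_minor (R : comNzRingType) (F : nat -> nat -> R) (n : nat) :
  row' ord_max (col' ord_max (leading_mx F n.+1)) = leading_mx F n.
Proof. by apply/matrixP => i j; rewrite !mxE !lift_max. Qed.

(** In the last column only the corner entry survives, since the entries above
    it lie beyond the superdiagonal of the original matrix. *)
Lemma det_offdiag_minor (R : comNzRingType) (F : nat -> nat -> R) (n : nat)
    (j : 'I_n.+2) :
    (forall i k, (i.+1 < k)%N -> F i k = 0) -> j = n :> nat ->
  \det (row' ord_max (col' j (leading_mx F n.+2))) =
    F n n.+1 * \det (leading_mx F n).
Proof.
move=> Fup jE; rewrite (expand_det_col _ ord_max) big_ord_recr big1 /= => [|i _].
  rewrite add0r !mxE lift_max /= jE /bump leqnn add1n /cofactor.
  rewrite /= -signr_odd addnn odd_double mul1r.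
  congr (_ * \det _); apply/matrixP => i k.
  have bump_n (m : 'I_n) : bump n m = m by rewrite /bump leqNgt ltn_ord.
  by rewrite !mxE !lift_max /= jE !bump_n.
by rewrite !mxE lift_max /= jE /bump leqnn add1n Fup ?mul0r // !ltnS ltn_ord.
Qed.

(** Vanishing below the subdiagonal leaves only the last two terms of the
    expansion along the last row; vanishing above the superdiagonal evaluates
    the minor of the first of them. *)
Lemma det_tridiag (R : comNzRingType) (F : nat -> nat -> R) (n : nat) :
    (forall i j, (i.+1 < j)%N -> F i j = 0) ->
    (forall i j, (j.+1 < i)%N -> F i j = 0) ->
  \det (leading_mx F n.+2) =
    F n.+1 n.+1 * \det (leading_mx F n.+1)
    - F n n.+1 * F n.+1 n * \det (leading_mx F n).
Proof.
move=> Fup Flow.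
rewrite (expand_det_row _ ord_max) !big_ord_recr big1 /= => [|i _].
  rewrite add0r !mxE /cofactor leading_minor det_offdiag_minor //=.
  (* The corner cofactor has sign +1 and its left neighbour sign -1. *)
  rewrite -[(-1) ^+ (_ + n)]signr_odd -[(-1) ^+ (_ + n.+1)]signr_odd.
  rewrite addnn odd_double addSn /= addnn odd_double expr1 !mul1r.
  by rewrite addrC mulN1r mulrN mulrCA mulrA.
by rewrite mxE Flow ?mul0r //= !ltnS ltn_ord.
Qed.

Definition lucas_entry (R : comNzRingType) (i j : nat) : {poly R} :=
  if i == j then 'X
  else if i == j.+1 then -1
  else if j == i.+1 then (if i == 0 then 2 else 1)
  else 0.

Lemma lucas_entry_upper (R : comNzRingType) (i j : nat) :
  (i.+1 < j)%N -> lucas_entry R i j = 0.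
Proof.
move=> lt_ij; rewrite /lucas_entry (gtn_eqF lt_ij) !ltn_eqF //.
  by rewrite (leq_trans (ltnW lt_ij)).
exact: ltnW.
Qed.

Lemma lucas_entry_lower (R : comNzRingType) (i j : nat) :
  (j.+1 < i)%N -> lucas_entry R i j = 0.
Proof.
move=> lt_ji; rewrite /lucas_entry (gtn_eqF lt_ji) gtn_eqF ?ltn_eqF //.
  by rewrite (leq_trans (ltnW lt_ji)).
exact: ltnW.
Qed.

Lemma det_lucas_mx_rec (R : comNzRingType) (n : nat) :
  \det (lucas_mx R n.+2) =
    (if n == 0 then 2 else 1) * \det (lucas_mx R n)
    + 'X * \det (lucas_mx R n.+1).
Proof.
have -> m : lucas_mx R m = leading_mx (lucas_entry R) m by [].
rewrite det_tridiag; [|exact: lucas_entry_upper|exact: lucas_entry_lower].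
rewrite /lucas_entry !eqxx (ltn_eqF (ltnSn n)) (gtn_eqF (ltnSn n)).
by rewrite (ltn_eqF (ltnW (ltnSn n.+1))) mulrN1 mulNr opprK addrC.
Qed.

Theorem mainTheorem3 (R : comNzRingType) (n : nat) (hn : (1 <= n)%N) :
  lucas R n.+1 = \det (lucas_mx R n).
Proof.
(* The recurrence has order two, so consecutive values go together. *)
suff [] : lucas R n.+1 = \det (lucas_mx R n)
       /\ lucas R n.+2 = \det (lucas_mx R n.+1) by [].
elim: n {hn} => [|n [IH0 IH1]]; first by rewrite det_mx00 det_mx11 mxE.
split=> //; rewrite det_lucas_mx_rec -IH0 -IH1.
by case: n {IH0 IH1} => [|n] //; rewrite lucasS // mul1r.
Qed.
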